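(* Consider the linear stochastic power system described in the context on a star graph with $n\ge2$ nodes, where node $1$ is the root, nodes $2,\dots,n$ are the others, and line $e_k$ is $(1,k+1)$ for $k=1,\dots,m=n-1$. Suppose $\mathbf M=\eta\mathbf I_n$ and $\mathbf D=d\mathbf I_n$ with $\eta,d>0$, and that all line weights are equal: $w_{i,j}=\gamma>0$ for all $(i,j)\in\mathcal E$. Then the asymptotic variances of the frequencies are $$q_{\omega_{1,1}}=\Big[\frac{1}{2d\eta}-\frac{\gamma(n-1)}{dn(2d^2+\gamma\eta n)}\Big]b_1^2+\frac{\gamma}{dn(2d^2+\gamma\eta n)}\big(\operatorname{tr}(\widetilde{\mathbf B}^2)-b_1^2\big),$$ and for $i=2,\dots,n$, $$\begin{aligned}q_{\omega_{i,i}}=&\ \frac{\gamma b_1^2}{dn(2d^2+\gamma\eta n)}+\frac{b_i^2}{2d\eta}-\frac{\gamma b_i^2}{dn(2d^2+\gamma\eta n)}-\frac{\gamma(n-2)b_i^2}{dn(2d^2(n+1)+\gamma\eta(n-1)^2)}\\&-\frac{\gamma^2\eta(n-2)b_i^2}{dn(2d^2+\gamma\eta)(2d^2+\gamma\eta n)}+\frac{\gamma\,(\operatorname{tr}(\widetilde{\mathbf B}^2)-b_i^2-b_1^2)}{dn(2d^2(1+n)+\gamma\eta(n-1)^2)}\\&+\frac{\gamma^2\eta}{dn(2d^2+\gamma\eta)(2d^2+\gamma\eta n)}\big(\operatorname{tr}(\widetilde{\mathbf B}^2)-b_i^2-b_1^2\big).\end{aligned}$$ The entries of the asymptotic variance matrix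 $\mathbf Q_\delta$ of the phase angle differences are, for $k\ne q$, $$\begin{aligned}q_{\delta_{k,q}}=&\ \frac{2d^2(n+1)+\gamma\eta(n-1)^2}{2d\gamma n(2d^2(1+n)+\gamma\eta(n-1)^2)}b_1^2+\frac{-2d^2(n-1)+\gamma\eta(2n-n^2+1)}{2d\gamma n(2d^2(1+n)+\gamma\eta(n-1)^2)}b_{k+1}^2\\&+\frac{-2d^2(n-1)+\gamma\eta(2n-n^2+1)}{2d\gamma n(2d^2(1+n)+\gamma\eta(n-1)^2)}b_{q+1}^2\\&+\frac{(2d^2+\gamma\eta(n+1))\big(\operatorname{tr}(\widetilde{\mathbf B}^2)-b_{k+1}^2-b_{q+1}^2-b_1^2\big)}{2d\gamma n(2d^2(1+n)+\gamma\eta(n-1)^2)},\end{aligned}$$ and for $k=1,\dots,m$, $$\begin{aligned}q_{\delta_{k,k}}=&\ \frac{1}{2d\gamma n}b_1^2+\Big(\frac{n-1}{2d\gamma n}-\frac{(n-2)(2d^2+\gamma\eta(n+1))}{2d\gamma n(2d^2(1+n)+\gamma\eta(n-1)^2)}\Big)b_{k+1}^2\\&+\frac{(2d^2+\gamma\eta(n+1))\big(\operatorname{tr}(\widetilde{\mathbf B}^2)-b_{k+1}^2-b_1^2\big)}{2d\gamma n(2d^2(1+n)+\gamma\eta(n-1)^2)}.\end{aligned}$$ Moreover $$\operatorname{tr}(\mathbf Q_\delta)=\frac{n-1}{2d\gamma n}\operatorname{tr}(\widetilde{\mathbf B}^2).$$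
   Context: Let $\mathcal G=(\mathcal V,\mathcal E)$ be a connected undirected graph with nodes $\mathcal V=\{1,\dots,n\}$ and lines $e_1,\dots,e_m$, with line weights $w_{i,j}=w_{j,i}>0$ for $(i,j)\in\mathcal E$ and $w_{i,j}=0$ otherwise (in the application $w_{i,j}=K_{i,j}\cos(\delta_i^*-\delta_j^* )$). A star graph is a tree with a root node directly connected to all the other nodes. $\mathbf L$ is the weighted Laplacian: $l_{i,j}=-w_{i,j}$ for $i\ne j$, $l_{i,i}=\sum_{k\neq i}w_{i,k}$. $\widetilde{\mathbf C}=(c_{i,k})\in\mathbb R^{n\times m}$ is the incidence matrix: $c_{i,k}=1$ if node $i$ is the beginning of $e_k$, $-1$ if it is the end, $0$ otherwise; for the star graph each line $e_k=(1,k+1)$ begins at the root $1$ and ends at $k+1$. $\mathbf M=\mathrm{diag}(m_i)$, $m_i>0$; $\mathbf D=\mathrm{diag}(d_i)$, $d_i>0$; $\widetilde{\mathbf B}=\mathrm{diag}(b_i)$, $b_i>0$. The stochastic system is $$\mathrm d\boldsymbol\delta=\boldsymbol\omega\,\mathrm dt,\qquad \mathrm d\boldsymbol\omega=-\mathbf M^{-1}(\mathbf L\boldsymbol\delta+\mathbf D\boldsymbol\omega)\,\mathrm dt+\mathbf M^{-1}\widetilde{\mathbf B}\,\mathrm d\mathbf v(t),$$ with $\mathbf v$ a standard $n$-dimensional Brownian motion, and output $\mathbf y=(\widetilde{\mathbf C}^\top\boldsymbol\delta,\boldsymbol\omega)\in\mathbb R^{m+n}$. Let $\mathbf U=[\mathbf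 u_1\cdots\mathbf u_n]$ be orthogonal with $\mathbf U^\top\mathbf M^{-1/2}\mathbf L\mathbf M^{-1/2}\mathbf U=\mathrm{diag}(\lambda_1,\dots,\lambda_n)$, $0=\lambda_1<\lambda_2\le\cdots\le\lambda_n$; $\widehat{\mathbf U}=[\mathbf u_2\cdots\mathbf u_n]$, $\mathbf\Lambda_{n-1}=\mathrm{diag}(\lambda_2,\dots,\lambda_n)$. Define $$\mathbf A_2=\begin{bmatrix}\mathbf 0&\mathbf A_{22}\\ \mathbf A_{23}&-\mathbf U^\top\mathbf M^{-1}\mathbf D\mathbf U\end{bmatrix},\quad \mathbf A_{22}=[\mathbf 0\ \ \mathbf I_{n-1}]\in\mathbb R^{(n-1)\times n},\quad \mathbf A_{23}^\top=[\mathbf 0\ \ -\mathbf\Lambda_{n-1}]\in\mathbb R^{(n-1)\times n},$$ $$\mathbf B_2=\begin{bmatrix}\mathbf 0\\ \mathbf U^\top\mathbf M^{-1/2}\widetilde{\mathbf B}\end{bmatrix}\in\mathbb R^{(2n-1)\times n},\qquad \mathbf C_2=\begin{bmatrix}\widetilde{\mathbf C}^\top\mathbf M^{-1/2}\widehat{\mathbf U}&\mathbf 0\\ \mathbf 0&\mathbf M^{-1/2}\mathbf U\end{bmatrix}\in\mathbb R^{(m+n)\times(2n-1)}.$$ With $\mathbf Q_x$ the unique solution of $\mathbf A_2\mathbf Q_x+\mathbf Q_x\mathbf A_2^\top+\mathbf B_2\mathbf B_2^\top=\mathbf 0$, the asymptotic variance of the output ($\lim_{t\to\infty}\mathrm{Cov}(\mathbf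 y(t))$, the variance in the invariant distribution) is $\mathbf Q_y=\mathbf C_2\mathbf Q_x\mathbf C_2^\top$ (may be taken as definition). $\mathbf Q_\delta=(q_{\delta_{k,q}})$ is its upper left $m\times m$ block (asymptotic covariance of $\widetilde{\mathbf C}^\top\boldsymbol\delta$) and $\mathbf Q_\omega=(q_{\omega_{i,j}})$ its lower right $n\times n$ block (asymptotic covariance of $\boldsymbol\omega$). *)

(* Defs.v *)
From HB Require Import structures.
From mathcomp Require Import all_boot all_order all_algebra.

Set Implicit Arguments.
Unset Strict Implicit.
Unset Printing Implicit Defensive.

Import Order.TTheory GRing.Theory Num.Theory.
Local Open Scope ring_scope.

(* The network has p.+1 nodes, so p stands for n - 1; the node numbered i in
   {1, ..., n} is the ordinal of value i - 1. *)
Record power_network (R : rcfType) (p m : nat) := PowerNetwork {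
  line_begin : 'I_m -> 'I_p.+1;
  line_end : 'I_m -> 'I_p.+1;
  weight : 'I_p.+1 -> 'I_p.+1 -> R;
  inertia : 'rV[R]_p.+1;
  damping : 'rV[R]_p.+1;
  noise : 'rV[R]_p.+1
}.

Section Network.

Variables (R : rcfType) (p m : nat) (S : power_network R p m).

Definition joins (k : 'I_m) : rel 'I_p.+1 := fun i j =>
  ((line_begin S k == i) && (line_end S k == j))
  || ((line_begin S k == j) && (line_end S k == i)).

Definition edge : rel 'I_p.+1 := fun i j => [exists k, joins k i j].

Definition connected_simple_graph : Prop :=
  [/\ forall k, line_begin S k != line_end S k,
      forall k q i j, joins k i j -> joins q i j -> k = q
    & forall i j, connect edge i j].

Definition admissible_weights : Prop :=
  [/\ forall i j, weight S i j = weight S j i,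
      forall i j, edge i j -> 0 < weight S i j
    & forall i j, ~~ edge i j -> weight S i j = 0].

Definition positive_parameters : Prop :=
  forall i, [/\ 0 < inertia S 0 i, 0 < damping S 0 i & 0 < noise S 0 i].

Definition laplacian : 'M[R]_p.+1 :=
  \matrix_(i, j) (if i == j then \sum_(k | k != i) weight S i k
                  else - weight S i j).

Definition incidence : 'M[R]_(p.+1, m) :=
  \matrix_(i, k) (if i == line_begin S k then 1
                  else if i == line_end S k then -1 else 0).

Definition inertia_mx : 'M[R]_p.+1 := diag_mx (inertia S).
Definition damping_mx : 'M[R]_p.+1 := diag_mx (damping S).
Definition noise_mx : 'M[R]_p.+1 := diag_mx (noise S).

(* M^{-1/2} for the diagonal matrix M = inertia_mx *)
Definition inertia_invsqrt : 'M[R]_p.+1 :=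
  diag_mx (map_mx (fun x => (Num.sqrt x)^-1) (inertia S)).

Definition spectral_decomposition (U : 'M[R]_p.+1) (lambda : 'rV[R]_p.+1) :
    Prop :=
  [/\ U^T *m U = 1%:M,
      U^T *m (inertia_invsqrt *m laplacian *m inertia_invsqrt) *m U
        = diag_mx lambda,
      lambda 0 ord0 = 0,
      forall i, i != ord0 -> 0 < lambda 0 i
    & forall i j : 'I_p.+1, (i <= j)%N -> lambda 0 i <= lambda 0 j].

Section Realization.

Variables (U : 'M[R]_p.+1) (lambda : 'rV[R]_p.+1).

Definition Uhat : 'M[R]_(p.+1, p) := col' ord0 U.

Definition Lambda : 'M[R]_p := diag_mx (col' ord0 lambda).

Definition A22 : 'M[R]_(p, 1 + p) := row_mx 0 1%:M.

Definition A23 : 'M[R]_(1 + p, p) := (row_mx 0 (- Lambda) : 'M_(p, 1 + p))^T.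

Definition A2 : 'M[R]_(p + p.+1) :=
  block_mx 0 A22
           A23 (- (U^T *m invmx inertia_mx *m damping_mx *m U)).

Definition B2 : 'M[R]_(p + p.+1, p.+1) :=
  col_mx 0 (U^T *m inertia_invsqrt *m noise_mx).

Definition C2 : 'M[R]_(m + p.+1, p + p.+1) :=
  block_mx (incidence^T *m inertia_invsqrt *m Uhat) 0
           0 (inertia_invsqrt *m U).

Definition lyapunov_solution (Qx : 'M[R]_(p + p.+1)) : Prop :=
  A2 *m Qx + Qx *m A2^T + B2 *m B2^T = 0.

(* Asymptotic variance of the output (C^T delta, omega) of the system
     d delta = omega dt,
     d omega = - M^{-1} (L delta + D omega) dt + M^{-1} B dv,
   taken as C2 Qx C2^T with Qx the solution of the Lyapunov equation. The state
   of the realization (A2, B2, C2) is (Uhat^T M^{1/2} delta, U^T M^{1/2} omega),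
   that is, the modal coordinates without the phase along u_1. *)
Definition output_variance (Qx : 'M[R]_(p + p.+1)) : 'M[R]_(m + p.+1) :=
  C2 *m Qx *m C2^T.

End Realization.

End Network.

Definition star_network (R : rcfType) (m : nat) (S : power_network R m m) :
    Prop :=
  forall k, line_begin S k = ord0 /\ line_end S k = lift ord0 k.

(* Main.v *)
Require Import Defs.
From HB Require Import structures.
From mathcomp Require Import all_boot all_order all_algebra.
From mathcomp Require Import ring lra.

Set Implicit Arguments.
Unset Strict Implicit.
Unset Printing Implicit Defensive.

Import Order.TTheory GRing.Theory Num.Theory.
Local Open Scope ring_scope.

(* The covariance equation decouples in the modal basis: for each pair [(i, j)]
   of modes it is a small linear system in the corresponding entries of the four
   blocks of [Qx], whose only solution multiplies entry [(i, j)] of the modal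
   noise covariance [N = U^T M^{-1/2} B^2 M^{-1/2} U] by a gain that depends
   only on [lambda_i] and [lambda_j]. Conjugating back by [U], the outputs become
   double sums of [E_a B^2 E_b] over spectral projectors of the Laplacian, which
   do not depend on the choice of [U]; for the star the eigenvalues are [0],
   [gamma / eta] and [gamma n / eta], with explicit projectors. *)

(** * Sums with few exceptional terms, and spectral projectors *)

(** For one output entry, all nodes except the root and the leaves concerned weigh their noise
    alike; splitting these off yields remainders such as [tr(B^2) - b_1^2] in the formulas. *)
Lemma sum_const_off (R : pzRingType) (I : finType) (s : seq I) (c f : I -> R)
    (A : R) :
  uniq s -> (forall t, t \notin s -> c t = A) ->
  \sum_t c t * f t
  = \sum_(t <- s) c t * f t + A * (\sum_t f t - \sum_(t <- s) f t).
Proof.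
move=> s_uniq cA; rewrite !(big_uniq _ s_uniq) (bigID [in s]) /=; congr (_ + _).
rewrite [X in _ * (X - _)](bigID [in s]) /= addrAC subrr add0r mulr_sumr.
by apply: eq_bigr => t /cA ->.
Qed.

(* Left multiplication by [K] forces row [i] of [U^T E_a U] to vanish unless
   [lambda_i = mu a]; as the [E_a] sum to the identity, each [U^T E_a U] is
   the whole identity on its own rows. *)
Lemma spectral_projector (R : idomainType) (n : nat) (A : finType)
    (E : A -> 'M[R]_n) (mu : A -> R) (K U : 'M[R]_n) (lambda : 'rV[R]_n) :
  injective mu -> U^T *m U = 1%:M -> U^T *m K *m U = diag_mx lambda ->
  \sum_a E a = 1%:M -> (forall a, K *m E a = mu a *: E a) ->
  forall a, U^T *m E a *m U = diag_mx (\row_i (lambda 0 i == mu a)%:R).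
Proof.
move=> mu_inj UU KU E1 KE a.
have UU' : U *m U^T = 1%:M := mulmx1C UU.
pose E' b := U^T *m E b *m U.
have LE b : diag_mx lambda *m E' b = mu b *: E' b.
  by rewrite -KU /E' !mulmxA -(mulmxA _ U) UU' mulmx1 -(mulmxA _ K) KE
    -!(scalemxAl, scalemxAr).
have E'0 b i j : lambda 0 i != mu b -> E' b i j = 0.
  move=> ne; have /matrixP/(_ i j) := LE b.
  rewrite mul_diag_mx !mxE => /eqP; rewrite -subr_eq0 -mulrBl mulf_eq0 subr_eq0.
  by rewrite (negPf ne) => /eqP.
have SE' i j : \sum_b E' b i j = (i == j)%:R.
  have <- : (\sum_b E' b) i j = (i == j)%:R.
    by rewrite -mulmx_suml -mulmx_sumr E1 mulmx1 UU mxE.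
  by rewrite summxE.
apply/matrixP => i j; rewrite -/(E' a) [RHS]mxE [X in X *+ _]mxE.
have [eqi|nei] := eqVneq (lambda 0 i) (mu a).
  rewrite -SE' (bigD1 a) //= big1 ?addr0 // => b ne_ba; apply: E'0.
  by rewrite eqi (inj_eq mu_inj) eq_sym.
by rewrite E'0 // mul0rn.
Qed.

(** In the basis [U] each [E a] is the 0-1 diagonal matrix marking the modes of eigenvalue [mu a],
    so entry [(i, j)] of the double sum keeps the single term with [mu a = lambda_i] and
    [mu b = lambda_j]. The right-hand side is free of [U]. *)
Lemma spectral_calculus (R : idomainType) (n : nat) (A : finType)
    (E : A -> 'M[R]_n) (mu : A -> R) (K U N : 'M[R]_n) (lambda : 'rV[R]_n)
    (f : R -> R -> R) :
  injective mu -> U^T *m U = 1%:M -> U^T *m K *m U = diag_mx lambda ->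
  \sum_a E a = 1%:M -> (forall a, K *m E a = mu a *: E a) ->
  U *m (\matrix_(i, j) (f (lambda 0 i) (lambda 0 j) * (U^T *m N *m U) i j))
    *m U^T
  = \sum_a \sum_b f (mu a) (mu b) *: (E a *m N *m E b).
Proof.
move=> mu_inj UU KU E1 KE.
have UU' : U *m U^T = 1%:M := mulmx1C UU.
have EU := spectral_projector mu_inj UU KU E1 KE.
set W := \matrix_(i, j) _.
suff -> : W = \sum_a \sum_b f (mu a) (mu b)
    *: ((U^T *m E a *m U) *m (U^T *m N *m U) *m (U^T *m E b *m U)).
  rewrite mulmx_sumr mulmx_suml; apply: eq_bigr => a _.
  rewrite mulmx_sumr mulmx_suml; apply: eq_bigr => b _.
  rewrite -scalemxAr -scalemxAl !mulmxA UU' mul1mx.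
  by rewrite -!(mulmxA _ U U^T) UU' !mulmx1.
apply/matrixP => i j; rewrite mxE summxE.
under eq_bigr => a _ do rewrite summxE.
under eq_bigr => a _ do under eq_bigr => b _ do
  rewrite !EU mxE mul_mx_diag mul_diag_mx.
(* An eigenvalue outside the range of [mu] would make the diagonal entry [(k, k)] of the identity
   equal to [0]. *)
have ex_mu k : exists a, lambda 0 k = mu a.
  have /matrixP/(_ k k) : \sum_a U^T *m E a *m U = 1%:M.
    by rewrite -mulmx_suml -mulmx_sumr E1 mulmx1.
  rewrite summxE !mxE eqxx; under eq_bigr => a _ do rewrite EU !mxE eqxx.
  have [/existsP[a /eqP ?]|/existsPn h] :=
    boolP [exists a, lambda 0 k == mu a]; first by exists a.
  rewrite big1 => [/eqP|a _]; last by rewrite (negPf (h a)).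
  by rewrite eq_sym oner_eq0.
have [a ia] := ex_mu i; have [b jb] := ex_mu j.
rewrite (bigD1 a) //= (bigD1 b) //= !big1 ?addr0.
- by rewrite !mxE ia jb !eqxx mul1r mulr1.
- move=> a' ne; rewrite big1 // => b' _; rewrite !mxE ia (inj_eq mu_inj).
  by rewrite [a == a']eq_sym (negPf ne) !(mul0r, mulr0).
move=> b' ne; rewrite !mxE jb (inj_eq mu_inj).
by rewrite [b == b']eq_sym (negPf ne) !(mul0r, mulr0).
Qed.

(** * Removal of the rigid mode from the phase coordinates *)

Lemma A22E (R : rcfType) (m : nat) : A22 R m = row' ord0 1%:M.
Proof.
apply/matrixP => i j; rewrite [RHS]mxE !mxE.
by case: split_ordP => k -> /=; rewrite !mxE; [case: k => -[] | ].
Qed.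

Lemma mul_row'1 (R : pzRingType) (m q : nat) (Y : 'M[R]_(m.+1, q)) :
  row' ord0 1%:M *m Y = row' ord0 Y.
Proof. by rewrite !row'Esub mul_rowsub_mx mul1mx. Qed.

Lemma mul_tr_row'1 (R : comPzRingType) (m q : nat) (X : 'M[R]_(q, m.+1)) :
  X *m (row' ord0 1%:M)^T = col' ord0 X.
Proof. by apply: trmx_inj; rewrite trmx_mul trmxK mul_row'1 tr_col'. Qed.

Lemma A23E (R : rcfType) (m : nat) (lambda : 'rV[R]_m.+1) :
  lambda 0 ord0 = 0 ->
  A23 lambda = - (diag_mx lambda *m (row' ord0 1%:M)^T).
Proof.
move=> l0; rewrite mul_tr_row'1; apply/matrixP => i j; rewrite mxE.
rewrite !mxE; case: split_ordP => k -> /=; rewrite !mxE.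
  have -> : lshift m k = ord0 by apply: val_inj; rewrite (ord1 k).
  by rewrite l0 mul0rn oppr0.
by rewrite rshift1 (inj_eq lift_inj) eq_sym; case: eqP => // ->.
Qed.

(** * Gains and the covariance equation in the modal basis *)

(** This is the resultant of [s^2 + a s + x] and [s^2 - a s + y], that is, the product of the four
    sums of a root of [s^2 + a s + x] and a root of [s^2 + a s + y]: the determinant of the Lyapunov
    operator on a pair of oscillators with damping rate [a]. *)
Definition modal_den (R : comPzRingType) (a x y : R) : R :=
  (x - y) ^+ 2 + 2 * a ^+ 2 * (x + y).

(* The rigid mode, of eigenvalue [0], has no phase coordinate in the realization;
   gain [0] lets phase covariances be handled as square matrices on all modes. *)
Definition phase_gain (R : fieldType) (a x y : R) : R :=
  if (x == 0) || (y == 0) then 0 else 2 * a / modal_den a x y.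

Definition cross_gain (R : fieldType) (a x y : R) : R :=
  (x - y) / modal_den a x y.

(** For nonnegative eigenvalues the first case is the rigid mode paired with itself, where
    [modal_den] vanishes and only the scalar equation [2 a w = N] remains. *)
Definition freq_gain (R : fieldType) (a x y : R) : R :=
  if x + y == 0 then (2 * a)^-1 else a * (x + y) / modal_den a x y.

Definition phase_cov (R : fieldType) (n : nat) (a : R) (lambda : 'rV[R]_n)
    (N : 'M[R]_n) : 'M[R]_n :=
  \matrix_(i, j) (phase_gain a (lambda 0 i) (lambda 0 j) * N i j).

Definition freq_cov (R : fieldType) (n : nat) (a : R) (lambda : 'rV[R]_n)
    (N : 'M[R]_n) : 'M[R]_n :=
  \matrix_(i, j) (freq_gain a (lambda 0 i) (lambda 0 j) * N i j).

Definition cross_cov (R : fieldType) (n : nat) (a : R) (lambda : 'rV[R]_n)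
    (N : 'M[R]_n) : 'M[R]_n :=
  \matrix_(i, j) (cross_gain a (lambda 0 i) (lambda 0 j) * N i j).

(** The upper left block of the equation asks for opposite cross entries, whence the minus sign.
    Index [ord0] is cut on the phase side only. *)
Definition modal_cov (R : fieldType) (m : nat) (a : R)
    (lambda : 'rV[R]_m.+1) (N : 'M[R]_m.+1) : 'M[R]_(m + m.+1) :=
  block_mx (row' ord0 (col' ord0 (phase_cov a lambda N)))
           (row' ord0 (cross_cov a lambda N))
           (- col' ord0 (cross_cov a lambda N))
           (freq_cov a lambda N).

Lemma modal_den_gt0 (R : realFieldType) (a x y : R) :
  0 < a -> 0 <= x -> 0 <= y -> 0 < x + y -> 0 < modal_den a x y.
Proof.
move=> a0 x0 y0 xy0; apply: ltr_wpDl; first exact: sqr_ge0.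
by rewrite !mulr_gt0 ?exprn_gt0.
Qed.

(* Here [p], [c], [c'] and [w] are the entries of the upper left, upper right,
   lower left and lower right blocks of [Qx] for one pair of modes, of nonzero
   eigenvalues [x] and [y], and [a = d / eta]. *)
Lemma mode_pair_system (R : realFieldType) (a x y N p c c' w : R) :
  0 < a -> 0 < x -> 0 < y ->
  [/\ c' + c = 0, w - (p * y + c * a) = 0, - (x * p + a * c') + w = 0
    & - (x * c + a * w) - (c' * y + w * a) + N = 0]
  <-> [/\ p = phase_gain a x y * N, c = cross_gain a x y * N,
          c' = - (cross_gain a x y * N) & w = freq_gain a x y * N].
Proof.
move=> a0 x0 y0; rewrite /phase_gain /cross_gain /freq_gain.
rewrite !gt_eqF ?addr_gt0 //=.
have den0 : 0 < modal_den a x y by rewrite modal_den_gt0 ?ltW ?addr_gt0.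
have /lt0r_neq0 := den0; have /lt0r_neq0 := a0.
rewrite /modal_den => a_neq0 den_neq0; split.
  move=> [h1 h2 h3 h4].
  have ec' : c' = - c by lra.
  have ew : w = p * y + c * a by lra.
  have ec : 2 * a * c = (x - y) * p.
    by rewrite ec' ew in h3; lra.
  have ep : p = 2 * a / ((x - y) ^+ 2 + 2 * a ^+ 2 * (x + y)) * N.
    (* Multiplying the last equation by [2 a] and inserting [2 a c = (x - y) p] and
       [2 a w = a (x + y) p] leaves [p] times the denominator. *)
    have eN : 2 * a * N = p * ((x - y) ^+ 2 + 2 * a ^+ 2 * (x + y)).
      have -> : N = (x - y) * c + 2 * a * w by rewrite ec' in h4; lra.
      have -> : 2 * a * ((x - y) * c + 2 * a * w)
          = (x - y) * (2 * a * c) + 2 * a * (2 * a * w) by ring.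
      have -> : 2 * a * w = 2 * a * y * p + a * (2 * a * c) by rewrite ew; ring.
      by rewrite ec; ring.
    by rewrite mulrAC eN mulfK.
  have ec2 : c = (x - y) / ((x - y) ^+ 2 + 2 * a ^+ 2 * (x + y)) * N.
    apply: (mulfI (x := 2 * a)); first by rewrite mulf_neq0 ?pnatr_eq0.
    by rewrite ec ep; ring.
  split=> //; first by rewrite ec' ec2.
  by rewrite ew ep ec2; ring.
by move=> [-> -> -> ->]; split; [ring | field | field | field];
  rewrite ?a_neq0 ?den_neq0.
Qed.

(* Same system when the second mode is the rigid one, of eigenvalue [0], which
   has no phase coordinate. *)
Lemma rigid_mode_system (R : realFieldType) (a x N c w : R) :
  0 < a -> 0 < x ->
  (w - c * a = 0 /\ - (x * c + a * w) - w * a + N = 0)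
  <-> (c = cross_gain a x 0 * N /\ w = freq_gain a x 0 * N).
Proof.
move=> a0 x0; rewrite /cross_gain /freq_gain subr0 addr0 gt_eqF //.
have den0 : 0 < modal_den a x 0 by apply: modal_den_gt0; rewrite ?addr0 // ltW.
have := lt0r_neq0 den0.
rewrite /modal_den subr0 addr0 => den_neq0; split.
  move=> [h1 h2]; have ew : w = c * a by lra.
  have ec : c = x / (x ^+ 2 + 2 * a ^+ 2 * x) * N.
    have -> : N = c * (x + 2 * a ^+ 2) by rewrite ew in h2; lra.
    by field; rewrite den_neq0.
  by split=> //; rewrite ew ec; ring.
by move=> [-> ->]; split; field; rewrite den_neq0.
Qed.

Lemma tr_row'1_mulE (R : pzRingType) (m q : nat) (X : 'M[R]_(m, q)) i j :
  ((row' ord0 1%:M)^T *m X) (lift ord0 i) j = X i j.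
Proof.
rewrite mxE (bigD1 i) //= !mxE eqxx mul1r big1 ?addr0 // => k ne_ki.
by rewrite !mxE (inj_eq lift_inj) (negPf ne_ki) mul0r.
Qed.

Lemma mul_row'1E (R : pzRingType) (m q : nat) (X : 'M[R]_(q, m)) i j :
  (X *m row' ord0 1%:M) i (lift ord0 j) = X i j.
Proof.
rewrite mxE (bigD1 j) //= !mxE eqxx mulr1 big1 ?addr0 // => k ne_kj.
by rewrite !mxE (inj_eq lift_inj) (negPf ne_kj) mulr0.
Qed.

Lemma modal_den_sym (R : comPzRingType) (a x y : R) :
  modal_den a x y = modal_den a y x.
Proof. by rewrite /modal_den; ring. Qed.

Lemma cross_gain_anti (R : fieldType) (a x y : R) :
  cross_gain a x y = - cross_gain a y x.
Proof. by rewrite /cross_gain modal_den_sym -mulNr opprB. Qed.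

Lemma freq_gain_sym (R : fieldType) (a x y : R) :
  freq_gain a x y = freq_gain a y x.
Proof. by rewrite /freq_gain modal_den_sym addrC. Qed.

(** The scalar damping [a] couples no two modes, so the block equation splits by pairs of indices:
    none, exactly one, or both rigid. The equivalence gives existence and uniqueness at once. *)
Lemma modal_lyapunov (R : realFieldType) (m : nat) (a : R)
    (lambda : 'rV[R]_m.+1) (N : 'M[R]_m.+1) (Q : 'M[R]_(m + m.+1)) :
  0 < a -> lambda 0 ord0 = 0 -> (forall i, i != ord0 -> 0 < lambda 0 i) ->
  let A := block_mx 0 (row' ord0 1%:M)
    (- (diag_mx lambda *m (row' ord0 1%:M)^T)) (- a%:M) : 'M[R]_(m + m.+1) in
  A *m Q + Q *m A^T + block_mx 0 0 0 N = 0 <-> Q = modal_cov a lambda N.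
Proof.
move=> a0 l0 lpos A.
have lpos' i : 0 < lambda 0 (lift ord0 i) by apply: lpos.
rewrite -[Q]submxK.
move: (ulsubmx Q) (ursubmx Q) (dlsubmx Q) (drsubmx Q) => P X Y W {Q}.
pose T : 'M[R]_(m, m.+1) := row' ord0 1%:M.
have -> : A *m block_mx P X Y W + block_mx P X Y W *m A^T + block_mx 0 0 0 N
  = block_mx
      (\matrix_(i, j) (Y (lift ord0 i) j + X i (lift ord0 j)))
      (\matrix_(i, j) (W (lift ord0 i) j
         - ((P *m T) i j * lambda 0 j + X i j * a)))
      (\matrix_(i, j) (- (lambda 0 i * (T^T *m P) i j + a * Y i j)
         + W i (lift ord0 j)))
      (\matrix_(i, j) (- (lambda 0 i * (T^T *m X) i j + a * W i j)
         - ((Y *m T) i j * lambda 0 j + W i j * a) + N i j)).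
  rewrite /A tr_block_mx !mulmx_block !add_block_mx !linearN /= trmx_mul trmxK.
  rewrite tr_diag_mx tr_scalar_mx trmx0 !mul0mx !mulmx0 !add0r !addr0.
  rewrite -/T !(mulmxA _ T) !mulNmx -!(mulmxA (diag_mx lambda)).
  move: (P *m T) (Y *m T) (T^T *m P) (T^T *m X) => PT YT TP TX.
  rewrite !mul_row'1 !mul_tr_row'1.
  rewrite !mul_mx_diag !mul_diag_mx !mul_scalar_mx !mul_mx_scalar.
  by congr block_mx; apply/matrixP => i j; rewrite !mxE //; ring.
split.
- rewrite -(@block_mx0 R m m.+1 m m.+1).
  move=> /eq_block_mx[/matrixP + /matrixP + /matrixP + /matrixP +].
  move=> UL UR DL DR.
  have {}UL i j := etrans (esym (mxE _ _ i j)) (etrans (UL i j) (mxE _ _ i j)).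
  have {}UR i j := etrans (esym (mxE _ _ i j)) (etrans (UR i j) (mxE _ _ i j)).
  have {}DL i j := etrans (esym (mxE _ _ i j)) (etrans (DL i j) (mxE _ _ i j)).
  have {}DR i j := etrans (esym (mxE _ _ i j)) (etrans (DR i j) (mxE _ _ i j)).
  have sol i j : [/\ P i j = phase_cov a lambda N (lift ord0 i) (lift ord0 j),
      X i (lift ord0 j) = cross_cov a lambda N (lift ord0 i) (lift ord0 j),
      Y (lift ord0 i) j = - cross_cov a lambda N (lift ord0 i) (lift ord0 j)
    & W (lift ord0 i) (lift ord0 j)
        = freq_cov a lambda N (lift ord0 i) (lift ord0 j)].
    rewrite !mxE; apply/(mode_pair_system _ _ _ _ _ a0 (lpos' i) (lpos' j)).
    have := UL i j; have := UR i (lift ord0 j).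
    have := DL (lift ord0 i) j; have := DR (lift ord0 i) (lift ord0 j).
    by rewrite /= !tr_row'1_mulE !mul_row'1E.
  have solR i : X i ord0 = cross_cov a lambda N (lift ord0 i) ord0
      /\ W (lift ord0 i) ord0 = freq_cov a lambda N (lift ord0 i) ord0.
    rewrite !mxE l0; apply/(rigid_mode_system _ _ _ a0 (lpos' i)).
    have := UR i ord0; have := DR (lift ord0 i) ord0.
    by rewrite /= !tr_row'1_mulE l0 !mulr0 !add0r.
  (* Exchanging the two modes reduces this to the preceding system, as [cross_gain] is antisymmetric
     and [freq_gain] symmetric. *)
  have solL j : Y ord0 j = - cross_cov a lambda N ord0 (lift ord0 j)
      /\ W ord0 (lift ord0 j) = freq_cov a lambda N ord0 (lift ord0 j).
    rewrite !mxE l0 cross_gain_anti mulNr opprK freq_gain_sym.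
    apply/(rigid_mode_system _ _ _ a0 (lpos' j)).
    have := DL ord0 j; have := DR ord0 (lift ord0 j).
    rewrite /= !mul_row'1E l0 !mul0r !add0r => e1 e2.
    by split; [rewrite -[RHS]e2 | rewrite -[RHS]e1]; ring.
  rewrite /modal_cov; congr block_mx; apply/matrixP => i j.
  - by have [-> _ _ _] := sol i j; rewrite !mxE.
  - rewrite [RHS]mxE; case: (unliftP ord0 j) => [j'|] ->.
      by have [_ -> _ _] := sol i j'.
    by have [-> _] := solR i.
  - rewrite mxE [X in - X]mxE; case: (unliftP ord0 i) => [i'|] ->.
      by have [_ _ -> _] := sol i' j.
    by have [-> _] := solL j.
  case: (unliftP ord0 i) => [i'|] ->; case: (unliftP ord0 j) => [j'|] ->.
  - by have [_ _ _ ->] := sol i' j'.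
  - by have [_ ->] := solR i'.
  - by have [_ ->] := solL j'.
  (* For the rigid mode paired with itself the equation reads [N = 2 a w]. *)
  have := DR ord0 ord0; rewrite !mxE /= l0 !mul0r !mulr0 !add0r.
  rewrite /freq_gain addr0 eqxx => e.
  have -> : N ord0 ord0 = 2 * a * W ord0 ord0 by lra.
  by rewrite mulKf // mulf_neq0 ?pnatr_eq0 ?lt0r_neq0.
move=> /eq_block_mx[-> -> -> ->]; rewrite -(@block_mx0 R m m.+1 m m.+1).
have sol i j : [/\ _, _, _ & _]
  := (mode_pair_system (N (lift ord0 i) (lift ord0 j))
     _ _ _ _ a0 (lpos' i) (lpos' j)).2 (And4 erefl erefl erefl erefl).
have solR i : _ /\ _ := (rigid_mode_system (N (lift ord0 i) ord0)
  _ _ a0 (lpos' i)).2 (conj erefl erefl).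
have solL j : _ /\ _ := (rigid_mode_system (N ord0 (lift ord0 j))
  _ _ a0 (lpos' j)).2 (conj erefl erefl).
congr block_mx; apply/matrixP => i j.
- by have [+ _ _ _] := sol i j; rewrite !mxE.
- case: (unliftP ord0 j) => [j'|] ->.
    by have [_ + _ _] := sol i j'; rewrite mxE mul_row'1E !mxE.
  by have [+ _] := solR i; rewrite !mxE l0 mulr0 add0r.
- case: (unliftP ord0 i) => [i'|] ->.
    by have [_ _ + _] := sol i' j; rewrite mxE tr_row'1_mulE !mxE.
  have [+ _] := solL j; rewrite !mxE l0 cross_gain_anti freq_gain_sym => e.
  by rewrite -[RHS]e; ring.
case: (unliftP ord0 i) => [i'|] ->; case: (unliftP ord0 j) => [j'|] ->.
- by have [_ _ _] := sol i' j'; rewrite mxE tr_row'1_mulE mul_row'1E !mxE.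
- have [_ +] := solR i'; rewrite mxE tr_row'1_mulE !mxE l0 => e.
  by rewrite -[RHS]e; ring.
- have [_ +] := solL j'; rewrite mxE mul_row'1E !mxE l0 cross_gain_anti.
  by rewrite freq_gain_sym => e; rewrite -[RHS]e; ring.
rewrite !mxE l0 /freq_gain addr0 eqxx; field.
by rewrite lt0r_neq0.
Qed.

(** * Spectral projectors of the star Laplacian *)

(** With unit weights, [0] belongs to the constant vectors, [1] to the vectors supported on the
    leaves with sum zero, and [n] to [hub_vec]. *)
Definition star_eig (R : pzRingType) (m : nat) (a : 'I_3) : R :=
  (nth 0 [:: 0; 1; m.+1] a)%:R.

Definition hub_vec (R : pzRingType) (m : nat) (i : 'I_m.+1) : R :=
  if i == ord0 then m%:R else -1.

(* The spectral projectors of the Laplacian of the star with unit weights, for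
   the eigenvalues [0], [1] and [n = m.+1]; the second one is [0] if [m = 1]. *)
Definition star_projector (R : fieldType) (m : nat) (a : 'I_3) : 'M[R]_m.+1 :=
  match val a with
  | 0%N => const_mx m.+1%:R^-1
  | 1%N => \matrix_(i, j) (if (i == ord0) || (j == ord0) then 0
                           else (i == j)%:R - m%:R^-1)
  | _ => \matrix_(i, j) (hub_vec R i * hub_vec R j / (m%:R * m.+1%:R))
  end.

Lemma star_eig_inj (R : numDomainType) (m : nat) :
  (0 < m)%N -> injective (@star_eig R m).
Proof.
case: m => // m _ a b /eqP; rewrite /star_eig eqr_nat => h; apply/val_inj.
by case: a b h => -[|[|[|a]]] // la [[|[|[|b]]] // lb].
Qed.

Lemma sum_star_projector (R : numFieldType) (m : nat) :
  (0 < m)%N -> \sum_a star_projector R m a = 1%:M.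
Proof.
move=> m0; have m0' : m%:R != 0 :> R by rewrite pnatr_eq0 -lt0n.
have n0 : 1 + m%:R != 0 :> R by rewrite -mulrS pnatr_eq0.
rewrite !big_ord_recl big_ord0 /star_projector /= addr0.
apply/matrixP => i j; rewrite !mxE /hub_vec.
case: (unliftP ord0 i) => [i'|] ->; case: (unliftP ord0 j) => [j'|] ->;
  rewrite /= ?(inj_eq lift_inj) mulrS; by field; rewrite m0' n0.
Qed.

Lemma star_edge (R : rcfType) (m : nat) (S : power_network R m m) i j :
  star_network S -> edge S i j = ((i == ord0) != (j == ord0)).
Proof.
move=> hstar; apply/existsP/idP => [[k]|].
  rewrite /joins; have [-> ->] := hstar k.
  by case/orP => /andP[/eqP <- /eqP <-].
case: (unliftP ord0 i) => [i'|] ->; case: (unliftP ord0 j) => [j'|] -> // _.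
  by exists i'; rewrite /joins; have [-> ->] := hstar i'; rewrite !eqxx orbT.
by exists j'; rewrite /joins; have [-> ->] := hstar j'; rewrite !eqxx.
Qed.

Lemma star_weight (R : rcfType) (m : nat) (S : power_network R m m) gamma i j :
  star_network S -> admissible_weights S ->
  (forall i j, edge S i j -> weight S i j = gamma) ->
  weight S i j = if (i == ord0) != (j == ord0) then gamma else 0.
Proof.
move=> hstar [_ _ w0] hw; rewrite -(star_edge _ _ hstar).
by case: ifP => [/hw|/negbT/w0].
Qed.

Lemma star_laplacian_mul (R : rcfType) (m q : nat) (S : power_network R m m)
    gamma (X : 'M[R]_(m.+1, q)) j :
  star_network S -> admissible_weights S ->
  (forall i j, edge S i j -> weight S i j = gamma) ->
  (laplacian S *m X) ord0 j
    = gamma * (m%:R * X ord0 j - \sum_k X (lift ord0 k) j)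
  /\ forall i, (laplacian S *m X) (lift ord0 i) j
    = gamma * (X (lift ord0 i) j - X ord0 j).
Proof.
move=> hstar hadm hw; have W i k := star_weight i k hstar hadm hw.
split=> [|i]; rewrite mxE big_ord_recl !mxE /=.
  have -> : \sum_(k < m.+1 | k != ord0) weight S ord0 k = gamma * m%:R.
    rewrite big_mkcond big_ord_recl /= add0r.
    under eq_bigr => k _ do rewrite W /=.
    by rewrite sumr_const card_ord mulr_natr.
  under eq_bigr => k _ do rewrite mxE /= W /= mulNr.
  by rewrite sumrN -mulr_sumr mulrBr mulrA.
rewrite (bigD1 i) //= !mxE eqxx W /=.
have -> : \sum_(k < m.+1 | k != lift ord0 i) weight S (lift ord0 i) k = gamma.
  rewrite big_mkcond big_ord_recl /= W /= big1 ?addr0 // => k _.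
  by rewrite W /= if_same.
rewrite big1 => [|k ne_ki]; first by ring.
by rewrite mxE (inj_eq lift_inj) eq_sym (negPf ne_ki) W /= oppr0 mul0r.
Qed.

Lemma star_laplacian_projector (R : rcfType) (m : nat)
    (S : power_network R m m) gamma a :
  (0 < m)%N -> star_network S -> admissible_weights S ->
  (forall i j, edge S i j -> weight S i j = gamma) ->
  laplacian S *m star_projector R m a
  = (gamma * star_eig R m a) *: star_projector R m a.
Proof.
move=> m0 hstar hadm hw.
have m0' : m%:R != 0 :> R by rewrite pnatr_eq0 -lt0n.
have n0 : 1 + m%:R != 0 :> R by rewrite -mulrS pnatr_eq0.
apply/matrixP => i j; rewrite [RHS]mxE -mulrA.
have [L0 Ll] := star_laplacian_mul (star_projector R m a) j hstar hadm hw.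
case: (unliftP ord0 i) => [i'|] ->; rewrite ?Ll ?L0; congr (_ * _).
  case: a {L0 Ll} => -[|[|[|a]]] // la; rewrite /star_projector /star_eig /=.
  - by rewrite !mxE; ring.
  - by rewrite !mxE /=; ring.
  by rewrite !mxE /hub_vec /= mulrS; field; rewrite m0' n0.
case: a {L0 Ll} => -[|[|[|a]]] // la; rewrite /star_projector /star_eig /=.
- by under eq_bigr => k _ do rewrite mxE;
    rewrite sumr_const card_ord mxE -mulr_natl; ring.
- case: (unliftP ord0 j) => [j'|] ->; last first.
    by rewrite big1 => [|k _]; rewrite !mxE /= ?mulr0 ?subr0.
  (* The leaf entries of this column sum to [1 - m / m = 0]. *)
  under eq_bigr => k _ do rewrite mxE /= (inj_eq lift_inj).
  rewrite sumrB sumr_const card_ord (bigD1 j') //= eqxx big1 => [|k /negPf->//].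
  by rewrite !mxE /= -[_^-1 *+ m]mulr_natl divff //; ring.
under eq_bigr => k _ do rewrite mxE {1}/hub_vec /=.
rewrite sumr_const card_ord !mxE {1}/hub_vec /= -mulr_natl mulrS.
by rewrite [X in _ = _ * (X * _ / _)]/hub_vec /=; field; rewrite m0' n0.
Qed.

(** * Uniform inertia and damping: state covariance and output blocks *)

Lemma uniform_inertia_invsqrt (R : rcfType) (p m : nat)
    (S : power_network R p m) (eta : R) :
  inertia_mx S = eta%:M -> inertia_invsqrt S = ((Num.sqrt eta)^-1)%:M.
Proof.
move=> hM; have eta_i i : inertia S 0 i = eta.
  by have /matrixP/(_ i i) := hM; rewrite !mxE eqxx !mulr1n.
by apply/matrixP => i j; rewrite !mxE eta_i.
Qed.

Lemma noise_mx_sqr (R : rcfType) (p m : nat) (S : power_network R p m) :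
  noise_mx S *m noise_mx S = diag_mx (\row_i noise S 0 i ^+ 2).
Proof.
by rewrite /noise_mx mulmx_diag; congr diag_mx; apply/rowP => i; rewrite !mxE.
Qed.

Lemma modal_noise_cov (R : rcfType) (p m : nat) (S : power_network R p m)
    (eta : R) (U : 'M[R]_p.+1) :
  0 < eta -> inertia_mx S = eta%:M ->
  B2 S U *m (B2 S U)^T
  = block_mx 0 0 0 (U^T *m diag_mx (\row_i (noise S 0 i ^+ 2 / eta)) *m U).
Proof.
move=> eta0 hM; rewrite /B2 tr_col_mx mul_col_row !trmx_mul trmx0 !mul0mx.
rewrite mulmx0 trmxK (uniform_inertia_invsqrt hM) tr_scalar_mx tr_diag_mx.
congr block_mx.
rewrite mul_scalar_mx mul_mx_scalar -!(scalemxAl, scalemxAr) scalerA.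
rewrite -invfM -expr2 sqr_sqrtr ?ltW // !mulmxA.
rewrite -[U^T *m _ *m diag_mx (noise S)]mulmxA -/(noise_mx S) noise_mx_sqr.
rewrite scalemxAl scalemxAr; congr (_ *m _ *m _).
by apply/matrixP => i j; rewrite !mxE mulrnAr mulrC.
Qed.

(** Uniform inertia and damping turn [U^T M^{-1} D U] into the scalar matrix [d / eta], which is
    what decouples the modes. *)
Lemma lyapunov_solution_iff (R : rcfType) (p m : nat) (S : power_network R p m)
    (eta d : R) (U : 'M[R]_p.+1) (lambda : 'rV[R]_p.+1) Qx :
  0 < eta -> 0 < d -> inertia_mx S = eta%:M -> damping_mx S = d%:M ->
  spectral_decomposition S U lambda ->
  lyapunov_solution S U lambda Qx
  <-> Qx = modal_cov (d / eta) lambda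
             (U^T *m diag_mx (\row_i (noise S 0 i ^+ 2 / eta)) *m U).
Proof.
move=> eta0 d0 hM hD [UU _ l0 lpos _].
rewrite -(modal_lyapunov _ _ (divr_gt0 d0 eta0) l0 lpos).
rewrite /lyapunov_solution (modal_noise_cov _ eta0 hM) /A2 A22E (A23E l0) hM hD.
by rewrite invmx_scalar !mul_mx_scalar scalerA -scalemxAl UU scalemx1.
Qed.

(** The phase outputs use [Uhat], which lacks the first column of [U]; this loses nothing on a
    matrix whose first row and column vanish. *)
Lemma col'_conj (R : comPzRingType) (m : nat) (U P : 'M[R]_m.+1) :
  (forall i, P i ord0 = 0) -> (forall j, P ord0 j = 0) ->
  col' ord0 U *m row' ord0 (col' ord0 P) *m (col' ord0 U)^T = U *m P *m U^T.
Proof.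
move=> Pi0 P0j; set P' := row' _ _.
rewrite -(mul_tr_row'1 U) trmx_mul trmxK.
set T := row' ord0 1%:M.
suff <- : T^T *m (P' *m T) = P by rewrite !mulmxA.
apply/matrixP => i j; case: (unliftP ord0 i) => [i'|] ->.
  rewrite tr_row'1_mulE; case: (unliftP ord0 j) => [j'|] ->.
    by rewrite mul_row'1E !mxE.
  by rewrite Pi0 mxE big1 // => k _; rewrite !mxE mulr0.
by rewrite P0j mxE big1 // => k _; rewrite !mxE mul0r.
Qed.

(** The zero blocks of [C2] keep phases and frequencies apart. Both blocks now contain a conjugate
    by the full [U], the form that [spectral_calculus] treats. *)
Lemma output_varianceE (R : rcfType) (p m : nat) (S : power_network R p m)
    (eta a : R) (U N : 'M[R]_p.+1) (lambda : 'rV[R]_p.+1) :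
  0 < eta -> inertia_mx S = eta%:M -> lambda 0 ord0 = 0 ->
  let Qy := output_variance S U (modal_cov a lambda N) in
  ulsubmx Qy = eta^-1 *: ((incidence S)^T
      *m (U *m phase_cov a lambda N *m U^T) *m incidence S)
  /\ drsubmx Qy = eta^-1 *: (U *m freq_cov a lambda N *m U^T).
Proof.
move=> eta0 hM l0 Qy; rewrite /Qy /output_variance /C2 /modal_cov.
rewrite (uniform_inertia_invsqrt hM) tr_block_mx !mulmx_block !trmx0.
rewrite !(mul0mx, mulmx0, add0r, addr0) block_mxKul block_mxKdr.
rewrite !trmx_mul !tr_scalar_mx !(mul_scalar_mx, mul_mx_scalar).
have sqrt_eta : (Num.sqrt eta)^-1 * (Num.sqrt eta)^-1 = eta^-1.
  by rewrite -invfM -expr2 sqr_sqrtr ?ltW.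
split; last by rewrite -!(scalemxAl, scalemxAr) scalerA sqrt_eta.
have P0 i : phase_cov a lambda N i ord0 = 0.
  by rewrite mxE /phase_gain l0 eqxx orbT mul0r.
have P0' j : phase_cov a lambda N ord0 j = 0.
  by rewrite mxE /phase_gain l0 eqxx mul0r.
rewrite -!(scalemxAl, scalemxAr) scalerA sqrt_eta; congr (_ *: _).
by rewrite -(col'_conj U P0 P0') !mulmxA trmxK.
Qed.

(** * Coefficients of the node variances for the star *)

(** Diagonal noise makes every output entry linear in the node variances [w_t]; exchanging the sums
    isolates the coefficient of each. *)
Lemma sum_conj_diagE (R : comPzRingType) (n q r : nat) (A : finType)
    (f : A -> A -> R) (E : A -> 'M[R]_n) (G : 'M[R]_(q, n)) (H : 'M[R]_(n, r))
    (w : 'rV[R]_n) k l :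
  (G *m (\sum_a \sum_b f a b *: (E a *m diag_mx w *m E b)) *m H) k l
  = \sum_t (\sum_a \sum_b f a b * (G *m E a) k t * (E b *m H) t l) * w 0 t.
Proof.
under [RHS]eq_bigr => t _ do rewrite mulr_suml.
rewrite mulmx_sumr mulmx_suml summxE exchange_big; apply: eq_bigr => a _ /=.
under [RHS]eq_bigr => t _ do rewrite mulr_suml.
rewrite mulmx_sumr mulmx_suml summxE exchange_big; apply: eq_bigr => b _ /=.
rewrite -scalemxAr -scalemxAl mxE !mulmxA -[_ *m E b *m H]mulmxA.
rewrite mul_mx_diag mxE mulr_sumr.
by apply: eq_bigr => t _; rewrite mxE; ring.
Qed.

(** Here [x] and [y] are eigenvalues for unit weights. At the pairs [(0, 1)], [(0, n)] and [(1, n)]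
    the denominator is [Z], [n X] and [Y] in the notation of [star_freq_coef]. *)
Lemma freq_gain_scaled (R : realFieldType) (eta d gamma x y : R) :
  0 < eta -> 0 < d -> 0 < gamma -> 0 <= x -> 0 <= y -> 0 < x + y ->
  freq_gain (d / eta) (gamma / eta * x) (gamma / eta * y)
  = d * eta * (x + y) / (2 * d ^+ 2 * (x + y) + gamma * eta * (x - y) ^+ 2).
Proof.
move=> eta0 d0 gamma0 x0 y0 xy0; rewrite /freq_gain -mulrDr.
rewrite gt_eqF ?mulr_gt0 ?invr_gt0 // /modal_den.
have den0 : 2 * d ^+ 2 * (x + y) + gamma * eta * (x - y) ^+ 2 != 0.
  apply/lt0r_neq0/ltr_pwDl; first by rewrite !mulr_gt0 ?exprn_gt0.
  by apply: mulr_ge0 (sqr_ge0 _); rewrite mulr_ge0 // ltW.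
field.
(* The denominator left by [field] is [gamma] times the one in the statement, hence nonzero. *)
have -> : (gamma * x - gamma * y) ^+ 2 * eta
    + 2 * d ^+ 2 * (gamma * x + gamma * y)
  = gamma * (2 * d ^+ 2 * (x + y) + gamma * eta * (x - y) ^+ 2) by ring.
by rewrite den0 (mulf_neq0 (lt0r_neq0 gamma0) den0) !lt0r_neq0.
Qed.

Lemma phase_gain_scaled (R : realFieldType) (eta d gamma x y : R) :
  0 < eta -> 0 < d -> 0 < gamma -> 0 < x -> 0 < y ->
  phase_gain (d / eta) (gamma / eta * x) (gamma / eta * y)
  = 2 * d * eta ^+ 2
    / (gamma * (2 * d ^+ 2 * (x + y) + gamma * eta * (x - y) ^+ 2)).
Proof.
move=> eta0 d0 gamma0 x0 y0; rewrite /phase_gain.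
have c0 : 0 < gamma / eta by rewrite divr_gt0.
rewrite !gt_eqF ?(mulr_gt0 c0) //= /modal_den.
have den0 : 2 * d ^+ 2 * (x + y) + gamma * eta * (x - y) ^+ 2 != 0.
  apply/lt0r_neq0/ltr_pwDl; first by rewrite !mulr_gt0 ?exprn_gt0 ?addr_gt0.
  by apply: mulr_ge0 (sqr_ge0 _); rewrite mulr_ge0 // ltW.
field.
have -> : (gamma * x - gamma * y) ^+ 2 * eta
    + 2 * d ^+ 2 * (gamma * x + gamma * y)
  = gamma * (2 * d ^+ 2 * (x + y) + gamma * eta * (x - y) ^+ 2) by ring.
by rewrite den0 (mulf_neq0 (lt0r_neq0 gamma0) den0) !lt0r_neq0.
Qed.

Lemma sum_I3 (V : nmodType) (F : 'I_3 -> V) :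
  \sum_a F a = F ord0 + F (lift ord0 ord0) + F ord_max.
Proof.
rewrite !big_ord_recl big_ord0 addr0 addrA.
by congr (_ + F _); apply: val_inj.
Qed.

(** [u] and [v] stand for entries of the three projectors at fixed indices. Pairs of equal
    eigenvalues all have gain [eta / (2 d)]; each unequal pair brings its own denominator. *)
Lemma star_freq_coef (R : realFieldType) (m : nat) (eta d gamma : R)
    (u v : 'I_3 -> R) :
  0 < eta -> 0 < d -> 0 < gamma ->
  let mu a := gamma / eta * star_eig R m a in
  let n : R := m.+1%:R in
  let X := 2 * d ^+ 2 + gamma * eta * n in
  let Y := 2 * d ^+ 2 * (n + 1) + gamma * eta * (n - 1) ^+ 2 in
  let Z := 2 * d ^+ 2 + gamma * eta in
  let i0 := ord0 in let i1 := lift ord0 ord0 in let i2 := ord_max in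
  \sum_a \sum_b freq_gain (d / eta) (mu a) (mu b) * u a * v b
  = eta * ((u i0 * v i0 + u i1 * v i1 + u i2 * v i2) / (2 * d)
      + (u i0 * v i1 + u i1 * v i0) * d / Z
      + (u i0 * v i2 + u i2 * v i0) * d / X
      + (u i1 * v i2 + u i2 * v i1) * (d * (n + 1)) / Y).
Proof.
move=> eta0 d0 gamma0 mu n X Y Z i0 i1 i2.
have n0 : 0 < n by rewrite ltr0n.
have eta_neq0 := lt0r_neq0 eta0; have d_neq0 := lt0r_neq0 d0.
have n_neq0 := lt0r_neq0 n0.
have X0 : X != 0.
  by rewrite lt0r_neq0 // addr_gt0 ?mulr_gt0 ?exprn_gt0.
have Z0 : Z != 0.
  by rewrite lt0r_neq0 // addr_gt0 ?mulr_gt0 ?exprn_gt0.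
have Y0 : Y != 0.
  apply/lt0r_neq0/ltr_pwDl; first by rewrite !mulr_gt0 ?exprn_gt0 ?addr_gt0.
  by apply: mulr_ge0 (sqr_ge0 _); rewrite mulr_ge0 // ltW.
have mu0 : mu i0 = gamma / eta * 0 by [].
have mu1 : mu i1 = gamma / eta * 1 by [].
have mu2 : mu i2 = gamma / eta * n by [].
clearbody n.
have G := freq_gain_scaled eta0 d0 gamma0.
have le01 : (0 <= 1 :> R) * (0 < 1 :> R) * (0 <= 0 :> R) * (0 <= n) by
  rewrite ler01 ltr01 lexx ltW.
have g00 : freq_gain (d / eta) (mu i0) (mu i0) = eta / (2 * d).
  by rewrite mu0 /freq_gain mulr0 addr0 eqxx; field; rewrite d_neq0 eta_neq0.
have g11 : freq_gain (d / eta) (mu i1) (mu i1) = eta / (2 * d).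
  by rewrite mu1 G ?addr_gt0 ?le01 // subrr expr0n mulr0 addr0; field;
    rewrite d_neq0.
have g22 : freq_gain (d / eta) (mu i2) (mu i2) = eta / (2 * d).
  rewrite mu2 G ?addr_gt0 ?le01 // subrr expr0n mulr0 addr0; field.
  by rewrite d_neq0 lt0r_neq0 ?addr_gt0.
have g01 : freq_gain (d / eta) (mu i0) (mu i1) = eta * (d / Z).
  by rewrite mu0 mu1 G ?add0r ?le01 // mulrA /Z; congr (_ / _); ring.
have g02 : freq_gain (d / eta) (mu i0) (mu i2) = eta * (d / X).
  rewrite mu0 mu2 G ?add0r ?le01 // sqrrN.
  have -> : 2 * d ^+ 2 * n + gamma * eta * n ^+ 2 = n * X by rewrite /X; ring.
  by field; rewrite X0 n_neq0.
have g12 : freq_gain (d / eta) (mu i1) (mu i2) = eta * (d * (n + 1) / Y).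
  rewrite mu1 mu2 G ?addr_gt0 ?le01 //.
  have -> : 2 * d ^+ 2 * (1 + n) + gamma * eta * (1 - n) ^+ 2 = Y
    by rewrite /Y; ring.
  by ring.
rewrite !sum_I3 (freq_gain_sym _ (mu i1) (mu i0)).
rewrite (freq_gain_sym _ (mu i2) (mu i0)) (freq_gain_sym _ (mu i2) (mu i1)).
rewrite g00 g11 g22 g01 g02 g12; move: (X^-1) (Y^-1) (Z^-1) => x y z.
by field; rewrite d_neq0.
Qed.

(** Pairs involving the eigenvalue [0] drop out because their phase gain is [0]. *)
Lemma star_phase_coef (R : realFieldType) (m : nat) (eta d gamma : R)
    (u v : 'I_3 -> R) :
  0 < eta -> 0 < d -> 0 < gamma ->
  let mu a := gamma / eta * star_eig R m a in
  let n : R := m.+1%:R in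
  let Y := 2 * d ^+ 2 * (n + 1) + gamma * eta * (n - 1) ^+ 2 in
  let i1 := lift ord0 ord0 in let i2 := ord_max in
  \sum_a \sum_b phase_gain (d / eta) (mu a) (mu b) * u a * v b
  = eta ^+ 2 * (u i1 * v i1 / (2 * d * gamma)
      + u i2 * v i2 / (2 * d * gamma * n)
      + (u i1 * v i2 + u i2 * v i1) * (2 * d) / (gamma * Y)).
Proof.
move=> eta0 d0 gamma0 mu n Y i1 i2.
have n0 : 0 < n by rewrite ltr0n.
have gamma_neq0 := lt0r_neq0 gamma0; have d_neq0 := lt0r_neq0 d0.
have n_neq0 := lt0r_neq0 n0.
have Y0 : Y != 0.
  apply/lt0r_neq0/ltr_pwDl; first by rewrite !mulr_gt0 ?exprn_gt0 ?addr_gt0.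
  by apply: mulr_ge0 (sqr_ge0 _); rewrite mulr_ge0 // ltW.
have mu0 : mu ord0 = 0 by rewrite /mu mulr0.
have mu1 : mu i1 = gamma / eta * 1 by [].
have mu2 : mu i2 = gamma / eta * n by [].
clearbody n.
have G := phase_gain_scaled eta0 d0 gamma0.
have g0l x : phase_gain (d / eta) (mu ord0) x = 0.
  by rewrite mu0 /phase_gain eqxx.
have g0r x : phase_gain (d / eta) x (mu ord0) = 0.
  by rewrite mu0 /phase_gain eqxx orbT.
have g11 : phase_gain (d / eta) (mu i1) (mu i1) = eta ^+ 2 / (2 * d * gamma).
  rewrite mu1 G // subrr expr0n mulr0 addr0; field.
  by rewrite d_neq0 gamma_neq0.
have g22 : phase_gain (d / eta) (mu i2) (mu i2)
    = eta ^+ 2 / (2 * d * gamma * n).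
  rewrite mu2 G // subrr expr0n mulr0 addr0; field.
  by rewrite ?d_neq0 ?gamma_neq0 ?n_neq0 lt0r_neq0 ?addr_gt0.
have g12 : phase_gain (d / eta) (mu i1) (mu i2)
    = eta ^+ 2 * (2 * d / (gamma * Y)).
  by rewrite mu1 mu2 G // mulrA /Y; congr (_ / _); ring.
have g21 : phase_gain (d / eta) (mu i2) (mu i1)
    = eta ^+ 2 * (2 * d / (gamma * Y)).
  by rewrite mu1 mu2 G // mulrA /Y; congr (_ / _); ring.
rewrite !sum_I3 !g0l !g0r g11 g22 g12 g21.
by field; rewrite Y0 gamma_neq0 n_neq0 d_neq0.
Qed.

(** Here [U] disappears: [M^{-1/2} L M^{-1/2}] is the unit-weight star Laplacian scaled by
    [gamma / eta], so the matrices [star_projector] serve as its spectral projectors in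
    [spectral_calculus]. *)
Lemma star_output (R : rcfType) (m : nat) (S : power_network R m m)
    (eta d gamma : R) (U : 'M[R]_m.+1) (lambda : 'rV[R]_m.+1) :
  (0 < m)%N -> star_network S -> admissible_weights S -> 0 < eta ->
  0 < gamma -> inertia_mx S = eta%:M ->
  (forall i j, edge S i j -> weight S i j = gamma) ->
  spectral_decomposition S U lambda ->
  let Qy := output_variance S U (modal_cov (d / eta) lambda
    (U^T *m diag_mx (\row_i (noise S 0 i ^+ 2 / eta)) *m U)) in
  let mu a := gamma / eta * star_eig R m a in
  let E := star_projector R m in
  (forall k q, ulsubmx Qy k q = eta^-1 * \sum_t
     (\sum_a \sum_b phase_gain (d / eta) (mu a) (mu b)
        * ((incidence S)^T *m E a) k t * (E b *m incidence S) t q)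
     * (noise S 0 t ^+ 2 / eta))
  /\ (forall i j, drsubmx Qy i j = eta^-1 * \sum_t
     (\sum_a \sum_b freq_gain (d / eta) (mu a) (mu b) * E a i t * E b t j)
     * (noise S 0 t ^+ 2 / eta)).
Proof.
move=> m0 hstar hadm eta0 gamma0 hM hw [UU UKU l0 _ _] Qy mu E.
have c0 : gamma / eta != 0 by rewrite lt0r_neq0 ?divr_gt0.
have mu_inj : injective mu.
  by move=> a b /(mulfI c0); apply: star_eig_inj m0 _ _.
have KE a : inertia_invsqrt S *m laplacian S *m inertia_invsqrt S *m E a
    = mu a *: E a.
  rewrite (uniform_inertia_invsqrt hM) mul_scalar_mx mul_mx_scalar scalerA.
  rewrite -invfM -expr2 sqr_sqrtr ?ltW // -scalemxAl.
  rewrite (star_laplacian_projector _ m0 hstar hadm hw) scalerA.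
  by congr (_ *: _); rewrite mulrCA mulrA.
have [-> ->] := output_varianceE (d / eta) U
  (U^T *m diag_mx (\row_i (noise S 0 i ^+ 2 / eta)) *m U) eta0 hM l0.
have calc f := spectral_calculus (diag_mx (\row_i (noise S 0 i ^+ 2 / eta))) f
  mu_inj UU UKU (sum_star_projector R m0) KE.
rewrite /phase_cov /freq_cov !calc; split=> i j; rewrite mxE; congr (_ * _).
  by rewrite sum_conj_diagE; apply: eq_bigr => t _; rewrite mxE.
(* Identity matrices take the place of the incidence matrices, so that the same expansion
   applies. *)
rewrite -[\sum_a _ in LHS]mulmx1 -[\sum_a _ in LHS]mul1mx sum_conj_diagE.
apply: eq_bigr => t _; rewrite mxE; congr (_ * _).
by apply: eq_bigr => a _; apply: eq_bigr => b _; rewrite mul1mx mulmx1.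
Qed.

Lemma star_incidence_mul (R : rcfType) (m q : nat) (S : power_network R m m)
    (X : 'M[R]_(m.+1, q)) k t :
  star_network S ->
  ((incidence S)^T *m X) k t = X ord0 t - X (lift ord0 k) t.
Proof.
move=> hstar; have [b e] := hstar k.
rewrite mxE big_ord_recl !mxE b eqxx mul1r; congr (_ + _).
rewrite (bigD1 k) //= !mxE b e /= eqxx mulN1r big1 ?addr0 // => i ne_ik.
by rewrite !mxE b e /= (inj_eq lift_inj) (negPf ne_ik) mul0r.
Qed.

Lemma tr_star_projector (R : fieldType) (m : nat) a :
  (star_projector R m a)^T = star_projector R m a.
Proof.
apply/matrixP => i j; rewrite mxE; case: a => -[|[|[|a]]] // la;
  rewrite /star_projector /= !mxE //.
  by rewrite orbC [j == i]eq_sym.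
by rewrite [hub_vec R j * _]mulrC.
Qed.

(** [u k] and [v] are the entries [(k, t)] of [C^T E] for the eigenvalues [1] and [n]. The latter
    does not depend on [k] because [hub_vec] drops by [n] along every line. *)
Lemma star_line_coef (R : rcfType) (m : nat) (S : power_network R m m)
    (eta d gamma : R) (k q : 'I_m) (t : 'I_m.+1) :
  (0 < m)%N -> star_network S -> 0 < eta -> 0 < d -> 0 < gamma ->
  let mu a := gamma / eta * star_eig R m a in
  let n : R := m.+1%:R in
  let Y := 2 * d ^+ 2 * (n + 1) + gamma * eta * (n - 1) ^+ 2 in
  let u k := if t == ord0 then 0
             else if t == lift ord0 k then m%:R^-1 - 1 else m%:R^-1 in
  let v := hub_vec R t / m%:R in
  \sum_a \sum_b phase_gain (d / eta) (mu a) (mu b)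
    * ((incidence S)^T *m star_projector R m a) k t
    * (star_projector R m b *m incidence S) t q
  = eta ^+ 2 * (u k * u q / (2 * d * gamma) + v ^+ 2 / (2 * d * gamma * n)
      + (u k + u q) * v * (2 * d) / (gamma * Y)).
Proof.
move=> m0 hstar eta0 d0 gamma0 mu n Y u v.
have m_neq0 : m%:R != 0 :> R by rewrite pnatr_eq0 -lt0n.
have n_neq0 : 1 + m%:R != 0 :> R by rewrite -mulrS pnatr_eq0.
have CE a l : ((incidence S)^T *m star_projector R m a) l t
    = star_projector R m a ord0 t - star_projector R m a (lift ord0 l) t.
  exact: star_incidence_mul.
have EC a l : (star_projector R m a *m incidence S) t l
    = ((incidence S)^T *m star_projector R m a) l t.
  by rewrite -{2}tr_star_projector -trmx_mul [RHS]mxE.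
have CE1 l : ((incidence S)^T *m star_projector R m (lift ord0 ord0)) l t = u l.
  rewrite CE /star_projector /= !mxE /= /u [lift _ _ == t]eq_sym mulrb.
  by case: eqP => _; [|case: eqP => _]; ring.
have CE2 l : ((incidence S)^T *m star_projector R m ord_max) l t = v.
  rewrite CE /star_projector /= !mxE {1 3}/hub_vec /= /v mulrS.
  by field; rewrite m_neq0 n_neq0.
rewrite star_phase_coef // !EC !CE1 !CE2 -/n -/Y.
by rewrite -expr2 [v * u q]mulrC -mulrDl.
Qed.

(** * Closed formulas for the asymptotic variances on the star *)

Theorem proposition4p9 (R : rcfType) (m : nat) (hn : (2 <= m.+1)%N)
    (S : power_network R m m)
    (hgraph : connected_simple_graph S)
    (hstar : star_network S)
    (hweight : admissible_weights S)
    (hpos : positive_parameters S)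
    (eta d gamma : R) (heta : 0 < eta) (hd : 0 < d) (hgamma : 0 < gamma)
    (hM : inertia_mx S = eta%:M)
    (hD : damping_mx S = d%:M)
    (hw : forall i j, edge S i j -> weight S i j = gamma)
    (U : 'M[R]_m.+1) (lambda : 'rV[R]_m.+1)
    (hU : spectral_decomposition S U lambda) :
  exists Qx : 'M[R]_(m + m.+1),
    unique (lyapunov_solution S U lambda) Qx /\
    let Qy := output_variance S U Qx in
    let Qdelta : 'M[R]_m := ulsubmx Qy in
    let Qomega : 'M[R]_m.+1 := drsubmx Qy in
    let n : R := m.+1%:R in
    let b := fun i : 'I_m.+1 => noise S 0 i in
    let b1 := b ord0 in
    let bl := fun k : 'I_m => b (lift ord0 k) in
    let trB2 := \tr (noise_mx S *m noise_mx S) in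
    [/\ Qomega ord0 ord0
        = (1 / (2 * d * eta)
           - gamma * (n - 1) / (d * n * (2 * d ^+ 2 + gamma * eta * n)))
          * b1 ^+ 2
          + gamma / (d * n * (2 * d ^+ 2 + gamma * eta * n))
            * (trB2 - b1 ^+ 2),

        forall i : 'I_m.+1, i != ord0 ->
        Qomega i i
        = gamma * b1 ^+ 2 / (d * n * (2 * d ^+ 2 + gamma * eta * n))
          + b i ^+ 2 / (2 * d * eta)
          - gamma * b i ^+ 2 / (d * n * (2 * d ^+ 2 + gamma * eta * n))
          - gamma * (n - 2) * b i ^+ 2
            / (d * n * (2 * d ^+ 2 * (n + 1) + gamma * eta * (n - 1) ^+ 2))
          - gamma ^+ 2 * eta * (n - 2) * b i ^+ 2
            / (d * n * (2 * d ^+ 2 + gamma * eta)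
               * (2 * d ^+ 2 + gamma * eta * n))
          + gamma * (trB2 - b i ^+ 2 - b1 ^+ 2)
            / (d * n * (2 * d ^+ 2 * (1 + n) + gamma * eta * (n - 1) ^+ 2))
          + gamma ^+ 2 * eta
            / (d * n * (2 * d ^+ 2 + gamma * eta)
               * (2 * d ^+ 2 + gamma * eta * n))
            * (trB2 - b i ^+ 2 - b1 ^+ 2),

        forall k q : 'I_m, k != q ->
        Qdelta k q
        = (2 * d ^+ 2 * (n + 1) + gamma * eta * (n - 1) ^+ 2)
          / (2 * d * gamma * n
             * (2 * d ^+ 2 * (1 + n) + gamma * eta * (n - 1) ^+ 2))
          * b1 ^+ 2
          + (- (2 * d ^+ 2 * (n - 1)) + gamma * eta * (2 * n - n ^+ 2 + 1))
            / (2 * d * gamma * n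
               * (2 * d ^+ 2 * (1 + n) + gamma * eta * (n - 1) ^+ 2))
            * bl k ^+ 2
          + (- (2 * d ^+ 2 * (n - 1)) + gamma * eta * (2 * n - n ^+ 2 + 1))
            / (2 * d * gamma * n
               * (2 * d ^+ 2 * (1 + n) + gamma * eta * (n - 1) ^+ 2))
            * bl q ^+ 2
          + (2 * d ^+ 2 + gamma * eta * (n + 1))
            * (trB2 - bl k ^+ 2 - bl q ^+ 2 - b1 ^+ 2)
            / (2 * d * gamma * n
               * (2 * d ^+ 2 * (1 + n) + gamma * eta * (n - 1) ^+ 2)),

        forall k : 'I_m,
        Qdelta k k
        = 1 / (2 * d * gamma * n) * b1 ^+ 2
          + ((n - 1) / (2 * d * gamma * n)
             - (n - 2) * (2 * d ^+ 2 + gamma * eta * (n + 1))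
               / (2 * d * gamma * n
                  * (2 * d ^+ 2 * (1 + n) + gamma * eta * (n - 1) ^+ 2)))
            * bl k ^+ 2
          + (2 * d ^+ 2 + gamma * eta * (n + 1))
            * (trB2 - bl k ^+ 2 - b1 ^+ 2)
            / (2 * d * gamma * n
               * (2 * d ^+ 2 * (1 + n) + gamma * eta * (n - 1) ^+ 2))
      & \tr Qdelta = (n - 1) / (2 * d * gamma * n) * trB2].
Proof.
have m0 : (0 < m)%N by [].
have [Q Q_sol] : exists Q, Q = modal_cov (d / eta) lambda
  (U^T *m diag_mx (\row_i (noise S 0 i ^+ 2 / eta)) *m U) by eexists.
have lyap := lyapunov_solution_iff _ heta hd hM hD hU.
exists Q; split; first by split=> [|Q' /lyap ->]; [exact/lyap|].
have [hdelta homega] := star_output d m0 hstar hweight heta hgamma hM hw hU.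
rewrite Q_sol; move: hdelta homega; set Qy := output_variance _ _ _.
move=> hdelta homega Qy' Qdelta Qomega n b b1 bl trB2.
have trB2E : trB2 = \sum_t b t ^+ 2.
  rewrite /trB2 noise_mx_sqr mxtrace_diag; apply: eq_bigr => t _.
  by rewrite mxE.
have p_gt0 : 0 < m%:R :> R by rewrite ltr0n.
have nE : n = m%:R + 1 by rewrite /n mulrSr.
have X0 : 2 * d ^+ 2 + gamma * eta * n != 0.
  by rewrite lt0r_neq0 // addr_gt0 ?mulr_gt0 ?exprn_gt0 ?ltr0n.
have Z0 : 2 * d ^+ 2 + gamma * eta != 0.
  by rewrite lt0r_neq0 // addr_gt0 ?mulr_gt0 ?exprn_gt0.
have Y0 : 2 * d ^+ 2 * (n + 1) + gamma * eta * (n - 1) ^+ 2 != 0.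
  apply/lt0r_neq0/ltr_pwDl.
    by rewrite !mulr_gt0 ?exprn_gt0 ?addr_gt0 ?ltr0n.
  by apply: mulr_ge0 (sqr_ge0 _); rewrite mulr_ge0 // ltW.
have n0 : n != 0 by rewrite pnatr_eq0.
have pE : m%:R = n - 1 by rewrite nE addrK.
have p0 : n - 1 != 0 by rewrite -pE lt0r_neq0.
have d_neq0 := lt0r_neq0 hd; have eta_neq0 := lt0r_neq0 heta.
have gamma_neq0 := lt0r_neq0 hgamma.
have nz := (X0, Y0, Z0, n0, p0, d_neq0, eta_neq0, gamma_neq0).
(* Two factors [1 / eta], one from the output map and one from the modal noise, join the coefficient
   of [b t ^+ 2]. *)
have {}homega i : Qomega i i = \sum_t (\sum_a \sum_b
    freq_gain (d / eta) (gamma / eta * star_eig R m a)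
                        (gamma / eta * star_eig R m b)
    * star_projector R m a i t * star_projector R m b t i) / eta ^+ 2
    * b t ^+ 2.
  rewrite /Qomega homega mulr_sumr; apply: eq_bigr => t _.
  by rewrite /b expr2 invfM; ring.
have {}hdelta k q : Qdelta k q = \sum_t (\sum_a \sum_b
    phase_gain (d / eta) (gamma / eta * star_eig R m a)
                         (gamma / eta * star_eig R m b)
    * ((incidence S)^T *m star_projector R m a) k t
    * (star_projector R m b *m incidence S) t q) / eta ^+ 2 * b t ^+ 2.
  rewrite /Qdelta hdelta mulr_sumr; apply: eq_bigr => t _.
  by rewrite /b expr2 invfM; ring.
rewrite ![1 + n]addrC.
(* Stated ahead of the five claims because it serves both the diagonal entries and the trace. *)
have hdiag k : Qdelta k k
  = 1 / (2 * d * gamma * n) * b1 ^+ 2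
    + ((n - 1) / (2 * d * gamma * n)
       - (n - 2) * (2 * d ^+ 2 + gamma * eta * (n + 1))
         / (2 * d * gamma * n
            * (2 * d ^+ 2 * (n + 1) + gamma * eta * (n - 1) ^+ 2)))
      * bl k ^+ 2
    + (2 * d ^+ 2 + gamma * eta * (n + 1))
      * (trB2 - bl k ^+ 2 - b1 ^+ 2)
      / (2 * d * gamma * n
         * (2 * d ^+ 2 * (n + 1) + gamma * eta * (n - 1) ^+ 2)).
  (* The constant is the weight of every leaf off line [k], read off the last term of the claim. *)
  rewrite hdelta (@sum_const_off _ _ [:: ord0; lift ord0 k] _ _
    ((2 * d ^+ 2 + gamma * eta * (n + 1)) / (2 * d * gamma * n
     * (2 * d ^+ 2 * (n + 1) + gamma * eta * (n - 1) ^+ 2)))) //.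
    rewrite !big_cons !big_nil !star_line_coef // -/n /hub_vec /= eqxx pE.
    rewrite -trB2E -/b1 -/(bl k); clearbody n trB2 b1 bl; field.
    by rewrite !nz.
  move=> t; rewrite !inE => /norP[t0 tk].
  rewrite star_line_coef // -/n /hub_vec (negPf t0) (negPf tk) /= pE.
  by clearbody n; field; rewrite !nz.
split=> [|i i_neq0|k q k_neq_q||].
(* All leaves weigh alike on the root frequency, so only the root is split off. *)
- rewrite homega (@sum_const_off _ _ [:: ord0] _ _
    (gamma / (d * n * (2 * d ^+ 2 + gamma * eta * n)))) //.
    rewrite !big_cons !big_nil star_freq_coef // /star_projector /= !mxE /=.
    rewrite /hub_vec /= pE -/n -trB2E -/b1; clearbody n trB2 b1; field.
    by rewrite !nz.
  move=> t; rewrite inE => t0.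
  rewrite star_freq_coef // /star_projector /= !mxE /= (negPf t0).
  rewrite /hub_vec (negPf t0) /= pE -/n; clearbody n; field.
  by rewrite !nz.
- rewrite homega (@sum_const_off _ _ [:: ord0; i] _ _
    (gamma / (d * n * (2 * d ^+ 2 * (n + 1) + gamma * eta * (n - 1) ^+ 2))
     + gamma ^+ 2 * eta / (d * n * (2 * d ^+ 2 + gamma * eta)
                           * (2 * d ^+ 2 + gamma * eta * n)))).
  + rewrite !big_cons !big_nil !star_freq_coef // /star_projector /= !mxE /=.
    rewrite /hub_vec !eqxx (negPf i_neq0) /= pE -/n -trB2E -/b1.
    clearbody n trB2 b1 b; field.
    by rewrite !nz.
  + by rewrite /= inE eq_sym i_neq0.
  move=> t; rewrite !inE => /norP[t0 ti].
  rewrite star_freq_coef // /star_projector /= !mxE /= (negPf t0).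
  rewrite (negPf i_neq0) /hub_vec (negPf t0) (negPf i_neq0) eq_sym (negPf ti).
  rewrite mulrb /= pE -/n.
  clearbody n; field.
  by rewrite !nz.
(* The ends of both lines are split off; the other leaves weigh as in the diagonal case. *)
- rewrite hdelta (@sum_const_off _ _ [:: ord0; lift ord0 k; lift ord0 q] _ _
    ((2 * d ^+ 2 + gamma * eta * (n + 1)) / (2 * d * gamma * n
     * (2 * d ^+ 2 * (n + 1) + gamma * eta * (n - 1) ^+ 2)))).
  + rewrite !big_cons !big_nil !star_line_coef // -/n /hub_vec /=.
    rewrite !(inj_eq lift_inj) !eqxx [q == k]eq_sym (negPf k_neq_q) pE -trB2E.
    rewrite -/b1 -/(bl k) -/(bl q); clearbody n trB2 b1 bl; field.
    by rewrite !nz.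
  + by rewrite /= !inE (inj_eq lift_inj) k_neq_q.
  move=> t; rewrite !inE => /norP[t0 /norP[tk tq]].
  rewrite star_line_coef // -/n /hub_vec (negPf t0) (negPf tk) (negPf tq) /= pE.
  by clearbody n; field; rewrite !nz.
- exact: hdiag.
rewrite /mxtrace; under eq_bigr => k _ do rewrite hdiag.
have sum_bl : \sum_k bl k ^+ 2 = trB2 - b1 ^+ 2.
  by rewrite trB2E big_ord_recl addrAC subrr add0r.
(* Once each summand is regrouped, the [n - 1] copies of [c (tr(B^2) - b_1^2)] cancel against
   [- (n - 1) c] times the sum of the leaf variances, so [c] leaves the trace. *)
pose c := (2 * d ^+ 2 + gamma * eta * (n + 1)) / (2 * d * gamma * n
  * (2 * d ^+ 2 * (n + 1) + gamma * eta * (n - 1) ^+ 2)).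
transitivity (\sum_(k < m)
    (1 / (2 * d * gamma * n) * b1 ^+ 2 + c * (trB2 - b1 ^+ 2)
     + ((n - 1) / (2 * d * gamma * n) - (n - 1) * c) * bl k ^+ 2)).
  apply: eq_bigr => k _; rewrite /c; move: (bl k) => x.
  by clearbody n trB2 b1; field; rewrite !nz.
rewrite big_split /= -mulr_sumr sum_bl sumr_const card_ord -[_ *+ m]mulr_natr.
by rewrite pE; move: c => c; clearbody n trB2 b1; field; rewrite !nz.
Qed.
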